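(* Let $d\in\mathbb{N}$ and $\alpha\in(0,2)$ with $0<\alpha<d<2\alpha$. The fractional Rollnik-class $\mathcal{R}_{d,\alpha}$ equipped with the norm $\|\cdot\|_{\mathcal{R}_{d,\alpha}}$ is a Banach space.
   Context: The fractional Rollnik-class $\mathcal{R}_{d,\alpha}$ (for $0<\alpha<2$, $\alpha<d<2\alpha$) is the set of measurable functions $V:\mathbb{R}^d\to\mathbb{R}$ (identified when equal a.e.) with $$\|V\|^2_{\mathcal{R}_{d,\alpha}}=\int_{\mathbb{R}^d}\int_{\mathbb{R}^d}\frac{|V(x)||V(y)|}{|x-y|^{2(d-\alpha)}}\,dx\,dy<\infty .$$ *)

(* Defs.v *)
From HB Require Import structures.
From mathcomp Require Import all_boot all_order all_algebra.
From mathcomp Require Import all_classical all_reals all_analysis.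

Set Implicit Arguments.
Unset Strict Implicit.
Unset Printing Implicit Defensive.

Import Order.TTheory GRing.Theory Num.Theory.
Import numFieldNormedType.Exports.

Local Open Scope classical_set_scope.
Local Open Scope ring_scope.

(* R^d, with the product (= Borel) sigma-algebra of the library on tuples. *)
Definition euclidean (R : realType) (d : nat) := d.-tuple (measurableTypeR R).
HB.instance Definition _ (R : realType) (d : nat) :=
  Measurable.on (euclidean R d).

Section lebesgue_measure_succ.
Context (R : realType) (d : nat).
Variable mu : {sigma_finite_measure set (euclidean R d) -> \bar R}.

Definition euclidean_cons (p : measurableTypeR R * euclidean R d) :
  euclidean R d.+1 := [tuple of p.1 :: p.2].

Lemma measurable_euclidean_cons : measurable_fun [set: _] euclidean_cons.
Proof. exact: measurable_cons. Qed.

Definition lebesgue_succ : set (euclidean R d.+1) -> \bar R :=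
  pushforward (@lebesgue_measure R \x mu)%E euclidean_cons.

HB.instance Definition _ := Measure.copy lebesgue_succ
  (measure_function_pushforward__canonical__measure_function_Measure
     (@lebesgue_measure R \x mu)%E measurable_euclidean_cons).

Lemma lebesgue_succ_sigma_finite : sigma_finite [set: _] lebesgue_succ.
Proof.
have /sigma_finiteP[F [FT ndF mF]] := sigma_finiteT (@lebesgue_measure R).
have /sigma_finiteP[G [GT ndG mG]] := sigma_finiteT mu.
pose uncons (x : euclidean R d.+1) : measurableTypeR R * euclidean R d :=
  (thead x, [tuple of behead x]).
have consK : cancel euclidean_cons uncons.
  by move=> [x y]; congr pair; exact: val_inj.
have muncons : measurable_fun [set: _] uncons.
  apply: measurable_fun_pair; first exact: measurable_tnth.
  exact: measurable_behead.
exists (fun i => uncons @^-1` (F i `*` G i)).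
  rewrite -preimage_bigcup (_ : \bigcup_i _ = setT) ?preimage_setT//.
  rewrite -setXTT FT GT; apply/seteqP; split => [[x y] [i _ [/= Fx Gy]]|].
    by split; exists i.
  move=> [x y] [/= [i _ Fx] [j _ Gy]]; exists (maxn i j) => //; split.
  - by move: x Fx; exact/subsetPset/ndF/leq_maxl.
  - by move: y Gy; exact/subsetPset/ndG/leq_maxr.
move=> i; have [mFi Fioo] := mF i; have [mGi Gioo] := mG i; split.
  by rewrite -[X in measurable X]setTI; apply: muncons => //; exact: measurableX.
rewrite /lebesgue_succ /pushforward -comp_preimage.
rewrite (_ : uncons \o _ = id) ?preimage_id; last exact/funext.
by rewrite product_measure1E// lte_mul_pinfty// ge0_fin_numE.
Qed.

HB.instance Definition _ := Measure_isSigmaFinite.Build _ _ _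
  lebesgue_succ lebesgue_succ_sigma_finite.

End lebesgue_measure_succ.

(* Lebesgue measure on R^d, as the d-fold product of the Lebesgue measure on R
   (point mass for d = 0). *)
Fixpoint lebesgue_euclidean (R : realType) (d : nat) :
    {sigma_finite_measure set (euclidean R d) -> \bar R} :=
  if d is d'.+1 then lebesgue_succ (lebesgue_euclidean R d')
  else dirac ([tuple] : euclidean R 0).

Definition euclidean_dist (R : realType) (d : nat) (x y : euclidean R d) : R :=
  Num.sqrt (\sum_(i < d) ((tnth x i : R) - tnth y i) ^+ 2).

(* On the diagonal, which is a null set as soon as d > 0, the integrand is 0
   because 0^-1 = 0. *)
Definition rollnik_norm (R : realType) (d : nat) (alpha : R)
    (V : euclidean R d -> R) : \bar R :=
  ((\int[lebesgue_euclidean R d]_x \int[lebesgue_euclidean R d]_y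
      (`|V x| * `|V y| /
         euclidean_dist x y `^ (2 * (d%:R - alpha)))%:E) `^ 2^-1)%E.

(* The elements are classes of measurable functions modulo equality almost
   everywhere; as in the library's Lp spaces, the norm of a class is computed on
   its canonical representative. *)
Record rollnik (R : realType) (d : nat) (alpha : R) := Rollnik {
  rollnik_class :>
    {mfun_ lebesgue_euclidean R d, euclidean R d >-> measurableTypeR R};
  rollnik_norm_lty : (rollnik_norm alpha rollnik_class < +oo)%E
}.

(* Main.v *)
(* The Riesz kernel is a superposition of Gaussians, and each Gaussian is an
   autocorrelation of a Gaussian of half the variance.  Hence
     |x - y| ^ (- s) = \int phi(x, w) phi(y, w) dw
   for a positive function phi, with w = (u, z), u in R the logarithm of the
   inverse square width and z in R^d the center of the Gaussian.  By Tonelli,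
   the Rollnik norm of V is the L^2 norm in w of \int |V(x)| phi(x, w) dx.  The
   triangle inequality and its countable version are then those of L^2, and the
   positivity of phi shows that a function of norm 0 vanishes almost everywhere
   and that a function with values in [0, +oo] of finite norm is finite almost
   everywhere; the Riesz-Fischer argument needs nothing more. *)
Require Import Defs.
From HB Require Import structures.
From mathcomp Require Import all_boot all_order all_algebra.
From mathcomp Require Import all_classical all_reals all_analysis.
From mathcomp Require Import measurable_realfun ring lra.
Import Order.TTheory GRing.Theory Num.Theory.
Import numFieldNormedType.Exports.
Local Open Scope classical_set_scope.
Local Open Scope ring_scope.

Set Implicit Arguments.
Unset Strict Implicit.
Unset Printing Implicit Defensive.

(** * Minkowski's inequality for functions with values in [0, +oo] *)

Section Lnorm2_nonneg.
Context d (T : measurableType d) (R : realType).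
Variable mu : {measure set T -> \bar R}.
Local Open Scope ereal_scope.
Implicit Types f g : T -> \bar R.

Lemma ae_lty_integral f : measurable_fun [set: T] f -> (forall x, 0 <= f x) ->
  \int[mu]_x f x < +oo -> {ae mu, forall x, f x < +oo}.
Proof.
move=> mf f0 foo.
have /(integrable_ae measurableT) : mu.-integrable setT f.
  apply/integrableP; split => //.
  by under eq_integral do rewrite gee0_abs//.
by apply: filterS => x /(_ I); rewrite ge0_fin_numE.
Qed.

Lemma ae_eq0_integral f : measurable_fun [set: T] f -> (forall x, 0 <= f x) ->
  \int[mu]_x f x = 0 -> {ae mu, forall x, f x = 0}.
Proof.
move=> mf f0 fi0.
have /(ae_eq_integral_abs mu measurableT mf) : \int[mu]_x `|f x| = 0.
  by under eq_integral do rewrite gee0_abs//.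
by apply: filterS => x /(_ I).
Qed.

Lemma poweR2E (x : \bar R) : 0 <= x -> x `^ 2 = x * x.
Proof.
case: x => [r|_|//]; last by rewrite poweRyr ?pnatr_eq0// mulyy.
by rewrite lee_fin => r0; rewrite poweR_EFin powR_mulrn.
Qed.

Lemma ae_eq_Lnorm f g (p : R) :
  measurable_fun [set: T] f -> measurable_fun [set: T] g ->
  {ae mu, forall x, f x = g x} -> 'N[mu]_p%:E[f] = 'N[mu]_p%:E[g].
Proof.
move=> mf mg fg; rewrite unlock; congr (_ `^ _).
have mp h : measurable_fun [set: T] h ->
    measurable_fun [set: T] (fun x => `|h x| `^ p).
  move=> mh; apply: (measurableT_comp (measurable_poweR p)).
  exact: measurableT_comp.
apply: ge0_ae_eq_integral => //; [exact: mp|exact: mp|..].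
- by move=> x _; exact: poweR_ge0.
- by move=> x _; exact: poweR_ge0.
- by apply: filterS fg => x ->.
Qed.

Lemma ge0_le_Lnorm f g (p : R) : (0 <= p)%R -> measurable_fun [set: T] f ->
  measurable_fun [set: T] g -> (forall x, 0 <= f x) ->
  (forall x, f x <= g x) -> 'N[mu]_p%:E[f] <= 'N[mu]_p%:E[g].
Proof.
move=> p0 mf mg f0 fg; rewrite unlock.
have g0 x : 0 <= g x by exact: le_trans (fg x).
have mp h : measurable_fun [set: T] h ->
    measurable_fun [set: T] (fun x => `|h x| `^ p).
  move=> mh; apply: (measurableT_comp (measurable_poweR p)).
  exact: measurableT_comp.
apply: gt0_ler_poweR; rewrite ?invr_ge0 ?in_itv/= ?leey ?andbT//.
- by apply: integral_ge0 => x _; exact: poweR_ge0.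
- by apply: integral_ge0 => x _; exact: poweR_ge0.
apply: ge0_le_integral => //; [|exact: mp|exact: mp|].
  by move=> x _; exact: poweR_ge0.
move=> x _; rewrite !gee0_abs//.
by apply: gt0_ler_poweR; rewrite ?in_itv/= ?leey ?andbT// ?f0 ?g0.
Qed.

Lemma ae_lty_Lnorm f (p : R) : (0 < p)%R -> measurable_fun [set: T] f ->
  (forall x, 0 <= f x) -> 'N[mu]_p%:E[f] < +oo ->
  {ae mu, forall x, f x < +oo}.
Proof.
move=> p0 mf f0; rewrite unlock => /lty_poweRy h.
have : {ae mu, forall x, `|f x| `^ p < +oo}.
  apply: ae_lty_integral; last by apply: h; rewrite invr_neq0// gt_eqF.
  - apply: (measurableT_comp (measurable_poweR p)); exact: measurableT_comp.
  - by move=> x; exact: poweR_ge0.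
apply: filterS => x /lty_poweRy; rewrite gt_eqF// => /(_ isT).
by rewrite gee0_abs.
Qed.

(** If a norm on the right is infinite there is nothing to prove. Otherwise [f] and [g] are finite
    almost everywhere, and the inequality for real-valued functions applies to their finite parts
    [f'] and [g']. *)
Lemma ge0_minkowski f g (p : R) : (1 <= p)%R ->
  measurable_fun [set: T] f -> measurable_fun [set: T] g ->
  (forall x, 0 <= f x) -> (forall x, 0 <= g x) ->
  'N[mu]_p%:E[f \+ g] <= 'N[mu]_p%:E[f] + 'N[mu]_p%:E[g].
Proof.
move=> p1 mf mg f0 g0; have p0 : (0 < p)%R by exact: lt_le_trans p1.
have [->|Nf] := eqVneq 'N[mu]_p%:E[f] +oo.
  by rewrite addye ?leey// -ltNye (lt_le_trans _ (Lnorm_ge0 _ _ _)).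
have [->|Ng] := eqVneq 'N[mu]_p%:E[g] +oo.
  by rewrite addey ?leey// -ltNye (lt_le_trans _ (Lnorm_ge0 _ _ _)).
have aef : {ae mu, forall x, f x < +oo}.
  by apply: (ae_lty_Lnorm p0); rewrite ?ltey.
have aeg : {ae mu, forall x, g x < +oo}.
  by apply: (ae_lty_Lnorm p0); rewrite ?ltey.
pose f' := fine \o f; pose g' := fine \o g.
have mf' : measurable_fun [set: T] f' by exact: measurableT_comp.
have mg' : measurable_fun [set: T] g' by exact: measurableT_comp.
have -> : 'N[mu]_p%:E[f \+ g] = 'N[mu]_p%:E[EFin \o (f' \+ g')%R].
  apply: ae_eq_Lnorm; first exact: emeasurable_funD.
    by apply/measurable_EFinP; exact: measurable_funD.
  near=> x; rewrite /= EFinD !fineK ?ge0_fin_numE//; near: x => //.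
have -> : 'N[mu]_p%:E[f] = 'N[mu]_p%:E[EFin \o f'].
  apply: ae_eq_Lnorm => //; first exact/measurable_EFinP.
  by near=> x; rewrite /= fineK ?ge0_fin_numE//; near: x.
have -> : 'N[mu]_p%:E[g] = 'N[mu]_p%:E[EFin \o g'].
  apply: ae_eq_Lnorm => //; first exact/measurable_EFinP.
  by near=> x; rewrite /= fineK ?ge0_fin_numE//; near: x.
exact: minkowski_EFin.
Unshelve. all: by end_near. Qed.

Lemma Lnorm2_sum_le (f : (T -> \bar R)^nat) n :
  (forall n, measurable_fun [set: T] (f n)) -> (forall n x, 0 <= f n x) ->
  'N[mu]_2%:E[(fun x => \sum_(i < n) f i x)] <= \sum_(i < n) 'N[mu]_2%:E[f i].
Proof.
move=> mf f0; elim: n => [|n ih].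
  under eq_Lnorm do rewrite big_ord0.
  by rewrite big_ord0 (_ : (fun=> 0) = cst 0)// Lnorm0// eqe pnatr_eq0.
rewrite big_ord_recr/=; apply: le_trans (leeD ih (lexx _)).
under eq_Lnorm do rewrite big_ord_recr/=.
apply: (@ge0_minkowski (fun x => \sum_(i < n) f i x) (f n)) => //.
- by rewrite ler1n.
- by apply: emeasurable_sum.
- by move=> x; apply: sume_ge0.
Qed.

(** Monotone convergence applies to the squares of the partial sums [S n], and each [S n] is
    controlled by the finite triangle inequality. *)
Lemma Lnorm2_nneseries_le (f : (T -> \bar R)^nat) :
  (forall n, measurable_fun [set: T] (f n)) -> (forall n x, 0 <= f n x) ->
  'N[mu]_2%:E[(fun x => \sum_(n <oo) f n x)] <= \sum_(n <oo) 'N[mu]_2%:E[f n].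
Proof.
move=> mf f0.
pose S n x := \sum_(i < n) f i x.
have S0 n x : 0 <= S n x by apply: sume_ge0.
have mS n : measurable_fun [set: T] (S n) by exact: emeasurable_sum.
have ndS x : nondecreasing_seq (S ^~ x).
  by apply/nondecreasing_seqP => n; rewrite /S big_ord_recr/= leeDl.
have cS x : S ^~ x @ \oo --> \sum_(n <oo) f n x.
  rewrite /S.
  under eq_cvg do rewrite -(big_mkord xpredT (fun i => f i x)).
  by apply: is_cvg_nneseries => n _ _; exact: f0.
have s0 x : 0 <= \sum_(n <oo) f n x by apply: nneseries_ge0.
have N2 (g : T -> \bar R) : (forall x, 0 <= g x) ->
    'N[mu]_2%:E[g] = (\int[mu]_x (g x * g x)) `^ 2^-1.
  move=> g0; rewrite unlock; congr (_ `^ _); apply: eq_integral => x _.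
  by rewrite gee0_abs// poweR2E.
set M := \sum_(n <oo) _.
have M0 : 0 <= M by apply: nneseries_ge0 => n _ _; exact: Lnorm_ge0.
suff : \int[mu]_x ((\sum_(n <oo) f n x) * (\sum_(n <oo) f n x)) <= M `^ 2.
  move=> h; rewrite N2//.
  apply: (@le_trans _ _ ((M `^ 2) `^ 2^-1)).
    apply: gt0_ler_poweR; rewrite ?in_itv/= ?leey ?andbT ?poweR_ge0//.
    by apply: integral_ge0 => x _; rewrite mule_ge0.
  by rewrite -poweRrM mulfV ?poweRe1// pnatr_eq0.
have -> : \int[mu]_x ((\sum_(n <oo) f n x) * (\sum_(n <oo) f n x)) =
    limn (fun n => \int[mu]_x (S n x * S n x)).
  rewrite -monotone_convergence//.
  - apply: eq_integral => x _; apply/esym/cvg_lim => //.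
    apply: cvgeM; [|exact: cS..].
    (* A product of a value with itself never has the indeterminate form [0 * +oo], so the limit
       passes through it. *)
    by case: (\sum_(n <oo) f n x).
  - by move=> n; exact: emeasurable_funM.
  - by move=> n x _; exact: mule_ge0.
  - by move=> x _ m n mn; rewrite lee_pmul//; exact: ndS.
apply: lime_le.
  apply: ereal_nondecreasing_is_cvgn => m n mn; apply: ge0_le_integral => //.
  - by move=> x _; rewrite mule_ge0.
  - exact: emeasurable_funM.
  - exact: emeasurable_funM.
  - by move=> x _; rewrite lee_pmul//; exact: ndS.
apply: nearW => n.
have : 'N[mu]_2%:E[S n] <= M.
  apply: le_trans (Lnorm2_sum_le n mf f0) _.
  rewrite -(big_mkord xpredT (fun i => 'N[mu]_2%:E[f i])).
  by apply: nneseries_lim_ge => k _ _; exact: Lnorm_ge0.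
have I0 : 0 <= \int[mu]_x (S n x * S n x).
  by apply: integral_ge0 => x _; rewrite mule_ge0.
move=> h.
apply: (@le_trans _ _ ('N[mu]_2%:E[S n] `^ 2)).
  by rewrite N2// -poweRrM mulVf ?pnatr_eq0// poweRe1.
by apply: gt0_ler_poweR; rewrite ?in_itv/= ?leey ?andbT ?Lnorm_ge0.
Qed.

End Lnorm2_nonneg.

(** * Norms induced by a positive factor *)

Section increments.
Context (R : realType).
Implicit Types u : nat -> R.

Lemma cvg_summable_increments u :
  (\sum_(k <oo) `|u k.+1 - u k|%:E < +oo)%E -> cvgn u.
Proof.
move=> /nnseries_is_cvg-/(_ (fun=> normr_ge0 _)) cu.
have {}cu : cvgn (series (telescope u)) by exact: (@normed_cvg R R^o).
rewrite (_ : u = (fun n => u 0%N + series (telescope u) n)); last first.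
  by apply/funext => n; rewrite -eq_sum_telescope.
by apply: is_cvgD => //; exact: is_cvg_cst.
Qed.

(** Telescoping bounds the distance from [u n] to [u (n + m)] by the series, uniformly in [m]; then
    [m] tends to infinity. A divergent series makes the bound trivial. *)
Lemma increments_lim_le u n : cvgn u ->
  (`|limn u - u n|%:E <= \sum_(k <oo) `|u (n + k).+1 - u (n + k)%N|%:E)%E.
Proof.
move=> cu; set S := (\sum_(k <oo) _)%E.
have S0 : (0 <= S)%E by apply: nneseries_ge0.
have le m : (`|u (n + m)%N - u n|%:E <= S)%E.
  apply: (@le_trans _ _ (\sum_(0 <= k < m) `|u (n + k).+1 - u (n + k)%N|%:E)%E).
    rewrite sumEFin lee_fin; apply: le_trans (ler_norm_sum _ _ _).
    under eq_bigr do rewrite -addnS.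
    by rewrite (telescope_sumr (fun k => u (n + k)%N))// addn0.
  by apply: nneseries_lim_ge.
case: S S0 le => [r| |]//= r0 le; last by rewrite leey.
rewrite lee_fin.
have cS : `|u (n + m)%N - u n| @[m --> \oo] --> `|limn u - u n|.
  apply: cvg_norm; apply: cvgB; last exact: cvg_cst.
  have := cu; rewrite -(cvg_shiftn n).
  by under eq_fun do rewrite addnC.
apply: (cvgr_to_le cS).
by apply: nearW => m; rewrite -lee_fin.
Qed.

End increments.

(** * The [L^2] norm of the transform of a nonnegative function by a positive factor *)

Section kernel_norm.
Context d1 d2 (T : measurableType d1) (W : measurableType d2) (R : realType).
Variables (mu : {sigma_finite_measure set T -> \bar R}).
Variables (nu : {sigma_finite_measure set W -> \bar R}).
Variable phi : T * W -> R.
Hypothesis mphi : measurable_fun [set: T * W] phi.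
Hypothesis phi_gt0 : forall xw, 0 < phi xw.
Local Open Scope ereal_scope.
Implicit Types f g : T -> \bar R.

Definition ktrans f (w : W) := \int[mu]_x (f x * (phi (x, w))%:E).

Definition knorm f := 'N[nu]_2%:E[ktrans f].

Let phi_ge0 x w : 0 <= (phi (x, w))%:E.
Proof. by rewrite lee_fin ltW. Qed.

Let mphi1 w : measurable_fun [set: T] (fun x => (phi (x, w))%:E).
Proof. by apply/measurable_EFinP; exact: measurableT_comp. Qed.

Let mfphi f w : measurable_fun [set: T] f ->
  measurable_fun [set: T] (fun x => f x * (phi (x, w))%:E).
Proof. by move=> mf; exact: emeasurable_funM mf (mphi1 w). Qed.

Lemma ktrans_ge0 f w : (forall x, 0 <= f x) -> 0 <= ktrans f w.
Proof. by move=> f0; apply: integral_ge0 => x _; exact: mule_ge0. Qed.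

Lemma measurable_ktrans f : measurable_fun [set: T] f -> (forall x, 0 <= f x) ->
  measurable_fun [set: W] (ktrans f).
Proof.
move=> mf f0.
apply: (measurable_fun_fubini_tonelli_G
  (fun z : T * W => f z.1 * (phi z)%:E)).
  apply: emeasurable_funM; first exact: measurableT_comp.
  exact/measurable_EFinP.
by move=> [x w]; exact: mule_ge0.
Qed.

Lemma ae_eq_ktrans f g w : measurable_fun [set: T] f ->
  measurable_fun [set: T] g ->
  (forall x, 0 <= f x) -> (forall x, 0 <= g x) ->
  {ae mu, forall x, f x = g x} -> ktrans f w = ktrans g w.
Proof.
move=> mf mg f0 g0 fg; apply: ge0_ae_eq_integral => //.
- exact: mfphi.
- exact: mfphi.
- by move=> x _; exact: mule_ge0.
- by move=> x _; exact: mule_ge0.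
- by apply: filterS fg => x ->.
Qed.

Lemma ae_eq_knorm f g :
  measurable_fun [set: T] f -> measurable_fun [set: T] g ->
  (forall x, 0 <= f x) -> (forall x, 0 <= g x) ->
  {ae mu, forall x, f x = g x} -> knorm f = knorm g.
Proof. by move=> *; apply: eq_Lnorm => w; exact: ae_eq_ktrans. Qed.

Lemma ae_ge0_le_knorm f g : measurable_fun [set: T] f ->
  measurable_fun [set: T] g -> (forall x, 0 <= f x) -> (forall x, 0 <= g x) ->
  {ae mu, forall x, f x <= g x} -> knorm f <= knorm g.
Proof.
move=> mf mg f0 g0 fg.
apply: ge0_le_Lnorm => //;
  [exact: measurable_ktrans|exact: measurable_ktrans|..].
  by move=> w; exact: ktrans_ge0.
move=> w; apply: ae_ge0_le_integral => //.
- by move=> x _; exact: mule_ge0.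
- exact: mfphi.
- by move=> x _; exact: mule_ge0.
- exact: mfphi.
- by apply: filterS fg => x fgx _; exact: lee_wpmul2r.
Qed.

Lemma ge0_knormD f g : measurable_fun [set: T] f -> measurable_fun [set: T] g ->
  (forall x, 0 <= f x) -> (forall x, 0 <= g x) ->
  knorm (f \+ g) <= knorm f + knorm g.
Proof.
move=> mf mg f0 g0.
have -> : knorm (f \+ g) = 'N[nu]_2%:E[ktrans f \+ ktrans g].
  apply: eq_Lnorm => w; rewrite /= -ge0_integralD//; first last.
  - exact: mfphi.
  - by move=> x _; exact: mule_ge0.
  - exact: mfphi.
  - by move=> x _; exact: mule_ge0.
  by apply: eq_integral => x _; rewrite ge0_muleDl.
apply: ge0_minkowski; rewrite ?ler1n//.
- exact: measurable_ktrans.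
- exact: measurable_ktrans.
- by move=> w; exact: ktrans_ge0.
- by move=> w; exact: ktrans_ge0.
Qed.

(** The integral defining [ktrans] commutes with series of nonnegative terms, which leaves the
    countable triangle inequality of [L^2]. *)
Lemma knorm_nneseries_le (f : (T -> \bar R)^nat) :
  (forall n, measurable_fun [set: T] (f n)) -> (forall n x, 0 <= f n x) ->
  knorm (fun x => \sum_(n <oo) f n x) <= \sum_(n <oo) knorm (f n).
Proof.
move=> mf f0.
have -> : knorm (fun x => \sum_(n <oo) f n x) =
    'N[nu]_2%:E[(fun w => \sum_(n <oo) ktrans (f n) w)].
  apply: eq_Lnorm => w; rewrite -integral_nneseries//; first last.
  - by move=> n x _; exact: mule_ge0.
  - by move=> n; exact: mfphi.
  apply: eq_integral => x _; rewrite muleC -nneseriesZl//.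
  by apply: eq_eseriesr => n _; rewrite muleC.
apply: Lnorm2_nneseries_le.
- by move=> n; exact: measurable_ktrans.
- by move=> n w; exact: ktrans_ge0.
Qed.

Lemma ge0_knormZ f (a : R) :
  measurable_fun [set: T] f -> (forall x, 0 <= f x) ->
  (0 <= a)%R -> knorm (fun x => a%:E * f x) = a%:E * knorm f.
Proof.
move=> mf f0 a0.
(* The scalar is written as the root of its square so that it can move under the outer power [2^-1]
   and then into the integral. *)
rewrite /knorm unlock [in RHS](_ : a%:E = (a%:E `^ 2) `^ 2^-1); last first.
  by rewrite -poweRrM mulfV ?pnatr_eq0// poweRe1.
rewrite -poweRM ?poweR_ge0 ?integral_ge0//; last by move=> *; exact: poweR_ge0.
congr (_ `^ _); rewrite -ge0_integralZl//.
- apply: eq_integral => w _.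
  have -> : ktrans (fun x => a%:E * f x) w = a%:E * ktrans f w.
    rewrite /ktrans -ge0_integralZl//; last by move=> x _; exact: mule_ge0.
      by apply: eq_integral => x _; rewrite muleA.
    exact: mfphi.
  by rewrite abseM gee0_abs ?lee_fin// poweRM.
- apply: (measurableT_comp (measurable_poweR 2)).
  exact/measurableT_comp/measurable_ktrans.
- by move=> *; exact: poweR_ge0.
- exact: poweR_ge0.
Qed.

(** The square of [ktrans f w] is a double integral in [x] and [y]; Tonelli moves the integral over
    [w] inside, where it produces [k]. The identity for [k] is asked only for almost every [y],
    since for the Riesz kernel it fails at [y = x]. *)
Lemma knormE (k : T -> T -> R) f :
  (forall x, measurable_fun [set: T] (k x)) -> (forall x y, (0 <= k x y)%R) ->
  (forall x, {ae mu, forall y,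
     (k x y)%:E = \int[nu]_w (phi (x, w) * phi (y, w))%:E}) ->
  measurable_fun [set: T] f -> (forall x, 0 <= f x) ->
  knorm f = (\int[mu]_x \int[mu]_y (f x * f y * (k x y)%:E)) `^ 2^-1.
Proof.
move=> mk k0 kE mf f0; rewrite /knorm unlock; congr (_ `^ _).
have T0 w : 0 <= ktrans f w by exact: ktrans_ge0.
have mT := measurable_ktrans mf f0.
have mphi2 x : measurable_fun [set: W] (fun w => (phi (x, w))%:E).
  by apply/measurable_EFinP; exact: measurableT_comp.
have mphi12 x : measurable_fun [set: T * W]
    (fun z : T * W => (phi (x, z.2) * phi z)%:E).
  apply/measurable_EFinP; apply: measurable_funM => //.
  apply: (measurableT_comp mphi).
  exact: measurable_fun_pair.
have mffphi x : measurable_fun [set: T * W]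
    (fun z : T * W => f x * (phi (x, z.2))%:E * (f z.1 * (phi z)%:E)).
  apply: emeasurable_funM.
    by apply: emeasurable_funM => //; exact: (measurableT_comp (mphi2 x)).
  apply: emeasurable_funM; first exact: measurableT_comp.
  exact/measurable_EFinP.
(* One copy of [ktrans f w] in the square is opened as an integral over [x]; the other stays as a
   constant until [x] and [w] have been exchanged. *)
transitivity (\int[nu]_w \int[mu]_x (f x * (phi (x, w))%:E * ktrans f w)).
  apply: eq_integral => w _; rewrite gee0_abs// poweR2E//.
  rewrite ge0_integralZr//; first exact: mfphi.
  by move=> x _; exact: mule_ge0.
rewrite -(fubini_tonelli
  (fun z : T * W => f z.1 * (phi z)%:E * ktrans f z.2))/=; first last.
- by move=> [x w]; rewrite !mule_ge0.
- apply: emeasurable_funM; last exact: measurableT_comp.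
  apply: emeasurable_funM; first exact: measurableT_comp.
  exact/measurable_EFinP.
apply: eq_integral => x _.
(* With [x] fixed, the second copy is opened as an integral over [y], ready for the second
   exchange. *)
transitivity (\int[nu]_w \int[mu]_y
    (f x * (phi (x, w))%:E * (f y * (phi (y, w))%:E))).
  apply: eq_integral => w _; rewrite ge0_integralZl ?mule_ge0//.
    exact: mfphi.
  by move=> y _; exact: mule_ge0.
rewrite -(fubini_tonelli
  (fun z : T * W =>
     f x * (phi (x, z.2))%:E * (f z.1 * (phi z)%:E)))/=; first last.
- by move=> [y w]; rewrite !mule_ge0.
- exact: mffphi.
apply: ge0_ae_eq_integral => //.
- apply: (measurable_fun_fubini_tonelli_F
    (fun z : T * W => f x * (phi (x, z.2))%:E * (f z.1 * (phi z)%:E))) => //.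
  by move=> [y w]; rewrite !mule_ge0.
- apply: emeasurable_funM; first exact: emeasurable_funM.
  exact/measurable_EFinP.
- by move=> y _; apply: integral_ge0 => w _; rewrite !mule_ge0.
- by move=> y _; rewrite !mule_ge0 ?lee_fin.
- apply: filterS (kE x) => y kxy _; rewrite kxy -ge0_integralZl ?mule_ge0//.
  + by apply: eq_integral => w _; rewrite EFinM muleACA.
  + apply/measurable_EFinP; apply: measurable_funM;
      exact: measurableT_comp.
  + by move=> w _; rewrite lee_fin mulr_ge0// ltW.
Qed.

Hypothesis nuT : nu [set: W] != 0.

(** Otherwise the negligible exceptional set would be the whole space, whose measure is nonzero. *)
Let ae_exists (P : W -> Prop) : {ae nu, forall w, P w} -> exists w, P w.
Proof.
move=> [N [mN N0 PN]]; apply/not_existsP => nP; move/eqP: nuT; apply.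
apply/eqP; rewrite -measure_le0 -N0 le_measure ?inE// => w _.
by apply: PN; exact: nP.
Qed.

(** A single [w] with [ktrans f w = 0] suffices: there the integral of [f] against a positive
    function vanishes. *)
Lemma knorm_eq0 f : measurable_fun [set: T] f -> (forall x, 0 <= f x) ->
  knorm f = 0 -> {ae mu, forall x, f x = 0}.
Proof.
move=> mf f0 kf0.
have /ae_exists[w /(_ I)] : ktrans f = \0 %[ae nu].
  by apply: Lnorm_eq0_eq0 kf0; [exact: measurable_ktrans|rewrite lte_fin].
move=> /(ae_eq0_integral (mfphi w mf) (fun x => mule_ge0 (f0 x) (phi_ge0 x w))).
apply: filterS => x /eqP; rewrite mule_eq0 => /orP[/eqP//|].
by rewrite eqe gt_eqF.
Qed.

(** Again one [w] suffices, now with [ktrans f w] finite: an infinite value of [f] would stay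
    infinite after multiplication by a positive factor. *)
Lemma ae_lty_knorm f : measurable_fun [set: T] f -> (forall x, 0 <= f x) ->
  knorm f < +oo -> {ae mu, forall x, f x < +oo}.
Proof.
move=> mf f0 kfoo.
have /ae_exists[w] : {ae nu, forall w, ktrans f w < +oo}.
  apply: ae_lty_Lnorm kfoo => //; first exact: measurable_ktrans.
  by move=> w; exact: ktrans_ge0.
move=> /(ae_lty_integral (mfphi w mf) (fun x => mule_ge0 (f0 x) (phi_ge0 x w))).
apply: filterS => x; case: (f x) (f0 x) => [r _ _||]//; first exact: ltry.
by rewrite gt0_mulye// lte_fin.
Qed.

(** The sum [G 0] of all absolute increments has finite norm, hence is finite almost everywhere, and
    [u] converges pointwise there. The tail [G n] dominates the distance from the limit to [u n]. *)
Lemma knorm_riesz_fischer (u : nat -> T -> R) :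
  (forall n, measurable_fun [set: T] (u n)) ->
  \sum_(k <oo) knorm (fun x => `|u k.+1 x - u k x|%:E) < +oo ->
  exists2 v : T -> R, measurable_fun [set: T] v & forall n,
    knorm (fun x => `|v x - u n x|%:E) <=
    \sum_(k <oo) knorm (fun x => `|u (n + k).+1 x - u (n + k)%N x|%:E).
Proof.
move=> mu_ uoo.
pose a k x := `|u k.+1 x - u k x|%:E.
have ma k : measurable_fun [set: T] (a k).
  apply/measurable_EFinP/measurableT_comp => //; exact: measurable_funB.
pose G n x := \sum_(k <oo) a (n + k)%N x.
have a0 k x : 0 <= a k x by rewrite lee_fin.
have G0 n x : 0 <= G n x by apply: nneseries_ge0 => k _ _; exact: a0.
have mG n : measurable_fun [set: T] (G n).
  by apply: ge0_emeasurable_sum => *; rewrite ?a0//; exact: ma.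
have NG n : knorm (G n) <= \sum_(k <oo) knorm (a (n + k)%N).
  by apply: knorm_nneseries_le.
have Goo : {ae mu, forall x, G 0%N x < +oo}.
  by apply: ae_lty_knorm => //; exact: le_lt_trans (NG 0%N) _.
pose A := [set x | G 0%N x < +oo].
have mA : measurable A.
  by rewrite -[A]setTI; exact: emeasurable_fun_infty_o.
have cu x : A x -> cvgn (u ^~ x) by move=> Ax; exact: cvg_summable_increments.
(* Cutting off by the indicator of [A] makes [v] an everywhere pointwise limit of measurable
   functions. *)
pose v x := (limn (u ^~ x) * \1_A x)%R.
have mv : measurable_fun [set: T] v.
  apply: (@measurable_fun_cvg _ _ _ _ (fun n x => u n x * \1_A x)%R).
    by move=> n; apply: measurable_funM.
  move=> x _; rewrite /v indicE; have [/set_mem Ax|_] := boolP (x \in A).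
    by under eq_cvg do rewrite mulr1; rewrite mulr1; exact: cu.
  by under eq_cvg do rewrite mulr0; rewrite mulr0; exact: cvg_cst.
exists v => // n; apply: le_trans (NG n); apply: ae_ge0_le_knorm => //.
- by apply/measurable_EFinP/measurableT_comp => //; exact: measurable_funB.
- apply: filterS Goo => x Ax; rewrite /v indicE mem_set// mulr1.
  exact/increments_lim_le/cu.
Qed.

End kernel_norm.

(** * Riesz kernels as superpositions of Gaussians *)

Section gaussian.
Context (R : realType).
Local Open Scope ereal_scope.
Notation leb := (@lebesgue_measure R).

(** The integrand is the normal density of variance [1 / (2 * b)] divided by its peak value. *)
Lemma integral_gauss (b m : R) : (0 < b)%R ->
  \int[leb]_x (expR (- (b * (x - m) ^+ 2)))%:E = (Num.sqrt (pi / b))%:E.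
Proof.
move=> b0; set s : R := Num.sqrt (2 * b)^-1.
have s2 : (s ^+ 2 = (2 * b)^-1)%R by rewrite sqr_sqrtr// invr_ge0 mulr_ge0 ?ltW.
have s0 : s != 0%R by rewrite gt_eqF// sqrtr_gt0 invr_gt0 mulr_gt0.
have peak0 := normal_peak_gt0 s0.
have peakE : (normal_peak s)^-1%R = Num.sqrt (pi / b).
  rewrite /normal_peak invrK s2; congr Num.sqrt; field; exact: lt0r_neq0.
rewrite -peakE -[RHS]mule1 -(integral_normal_pdf m s) -ge0_integralZl_EFin//.
- apply: eq_integral => x _; rewrite -EFinM normal_pdfE// mulKf ?gt_eqF//.
  rewrite /normal_fun s2; congr (expR _)%:E; field; exact: lt0r_neq0.
- by move=> x _; rewrite lee_fin normal_pdf_ge0.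
- by apply/measurable_EFinP; exact: measurable_normal_pdf.
- by rewrite invr_ge0 ltW.
Qed.

Lemma measurable_sum_sqr d (m : 'I_d -> R) :
  measurable_fun [set: euclidean R d]
    (fun z => \sum_(i < d) ((tnth z i : R) - m i) ^+ 2)%R.
Proof.
apply: measurable_sum => i; apply: measurable_funX.
by apply: measurable_funB => //; exact: measurable_tnth.
Qed.

Lemma integral_lebesgue_euclideanS d (f : euclidean R d.+1 -> \bar R) :
  measurable_fun [set: euclidean R d.+1] f -> (forall z, 0 <= f z) ->
  \int[lebesgue_euclidean R d.+1]_z f z =
  \int[leb]_x \int[lebesgue_euclidean R d]_z f (euclidean_cons (x, z)).
Proof.
move=> mf f0.
rewrite [LHS](@ge0_integral_pushforward _ _ _ _ _ _
  (@measurable_euclidean_cons R d))//.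
rewrite preimage_setT fubini_tonelli1//; last by move=> x; exact: f0.
by apply: measurableT_comp => //; exact: measurable_euclidean_cons.
Qed.

(** The Gaussian factorizes over the coordinates; the induction splits off the first one. *)
Lemma integral_gauss_euclidean d (b : R) (m : 'I_d -> R) : (0 < b)%R ->
  \int[lebesgue_euclidean R d]_z
    (expR (- (b * \sum_(i < d) ((tnth z i : R) - m i) ^+ 2)))%:E =
  (Num.sqrt (pi / b) ^+ d)%:E.
Proof.
move=> b0.
have mg d' (m' : 'I_d' -> R) : measurable_fun [set: euclidean R d'] (fun z =>
    (expR (- (b * \sum_(i < d') ((tnth z i : R) - m' i) ^+ 2)))%:E).
  apply/measurable_EFinP; apply: (measurableT_comp (@measurable_expR R)).
  apply: measurableT_comp => //; apply: measurable_funM => //.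
  exact: measurable_sum_sqr.
elim: d m => [|d ih] m.
  rewrite integral_dirac// ?diracT ?mul1e.
    by rewrite big_ord0 mulr0 oppr0 expR0.
  exact: mg.
rewrite integral_lebesgue_euclideanS//.
transitivity (\int[leb]_x ((Num.sqrt (pi / b) ^+ d)%:E *
    (expR (- (b * (x - m ord0) ^+ 2)))%:E)).
  apply: eq_integral => x _; rewrite -(ih (m \o lift ord0)) muleC.
  rewrite -ge0_integralZl_EFin ?expR_ge0//.
  apply: eq_integral => z _; rewrite -EFinM -expRD; congr (expR _)%:E.
  rewrite big_ord_recl (tnth_nth 0%R)/=.
  under eq_bigr do rewrite (tnth_nth 0%R)/= -tnth_nth.
  by rewrite mulrDr opprD.
  exact: mg.
rewrite ge0_integralZl_EFin ?exprn_ge0//.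
  by rewrite integral_gauss// -EFinM exprSr.
apply/measurable_EFinP; apply: (measurableT_comp (@measurable_expR R)).
apply: measurableT_comp => //; apply: measurable_funM => //.
by apply: measurable_funX; exact: measurable_funB.
Qed.

(** The point lies in the hyperplane of points with the same first coordinate, which is null. In
    dimension 0 the measure is a point mass and the claim fails. *)
Lemma ae_neq_euclidean d (x : euclidean R d) : (0 < d)%N ->
  {ae lebesgue_euclidean R d, forall y, y <> x}.
Proof.
case: d x => [//|d] x _.
pose N := (fun y : euclidean R d.+1 => tnth y ord0) @^-1` [set tnth x ord0].
have mN : measurable N.
  rewrite -[N]setTI; apply: (measurable_tnth ord0) => //.
exists N; split => //; last by move=> y /= /contrapT ->.
rewrite /= /lebesgue_succ /pushforward.
have -> : @euclidean_cons R d @^-1` N = [set tnth x ord0] `*` setT.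
  by apply/seteqP; split => -[a b] /=;
    rewrite /N/= (tnth_nth 0%R)/=; [split|case].
rewrite product_measure1E//.
(* The other factor may have infinite measure; the product is still 0 because [0 * +oo] is 0. *)
by have /= -> := lebesgue_measure_set1 (tnth x ord0); rewrite mul0e.
Qed.

End gaussian.

(** * Negative powers as superpositions of exponentials *)

Section subordination.
Context (R : realType).
Local Open Scope ereal_scope.
Notation leb := (@lebesgue_measure R).

Let continuous_integrand (s r : R) :
  continuous (fun u => expR (s / 2 * u - expR u * r))%R.
Proof.
move=> u; apply: continuous_comp; last exact: continuous_expR.
apply: cvgB; first by apply: cvgM; [exact: cvg_cst|exact: cvg_id].
by apply: cvgM; [exact: continuous_expR|exact: cvg_cst].
Qed.

(** With [t = expR u] this is the scaling rule of the Gamma integral, and the integral on the right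
    is Gamma of [s / 2]. The logarithmic variable turns the scaling into a translation of the whole
    line. *)
Lemma integral_expR_expR (s r : R) : (0 < r)%R ->
  \int[leb]_u (expR (s / 2 * u - expR u * r ^+ 2))%:E =
  (r `^ (- s))%:E * \int[leb]_u (expR (s / 2 * u - expR u))%:E.
Proof.
move=> r0.
(* Translation by [2 ln r], i.e. the scaling of [expR u] by [r ^- 2]. *)
pose F (u : R) := (u - 2 * ln r)%R.
have F'E : F^`()%classic = cst 1%R.
  apply/funext => u; rewrite derive1E /F (@deriveD _ R^o R^o)//.
  by rewrite derive_id derive_cst addr0.
rewrite (@increasing_ge0_integration_by_substitutionT _ F).
- rewrite -ge0_integralZl_EFin ?powR_ge0//; last first.
    apply/measurable_EFinP; apply: continuous_measurable_fun => u.
    have := @continuous_integrand s 1 u.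
    by under eq_fun do rewrite mulr1.
  apply: eq_integral => u _; rewrite F'E /= mulr1 -EFinM; congr EFin.
  rewrite /powR gt_eqF// -expRD; congr expR.
  rewrite /F expRD expRN expRM_natl lnK ?posrE// divfK ?expf_neq0 ?gt_eqF//.
  by field.
- by move=> x y xy; rewrite ltr_leB.
- by rewrite F'E => ?; exact: cvg_cst.
- by rewrite F'E; exact: is_cvg_cst.
- by rewrite F'E; exact: is_cvg_cst.
- by move=> u; exact: derivableD.
- exact: cvg_addrr_Ny.
- exact: cvg_addrr.
- exact: continuous_integrand.
- by move=> u; exact: expR_ge0.
Qed.

Lemma integral_expR_expR_gt0 (s : R) :
  0 < \int[leb]_u (expR (s / 2 * u - expR u))%:E.
Proof.
have mf : measurable_fun [set: R] (fun u : R => (expR (s / 2 * u - expR u))%:E).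
  apply/measurable_EFinP; apply: continuous_measurable_fun => u.
  by have := @continuous_integrand s 1 u; under eq_fun do rewrite mulr1.
have f0 u : 0 <= (expR (s / 2 * u - expR u))%:E by rewrite lee_fin expR_ge0.
rewrite lt0e integral_ge0// andbT; apply/eqP => i0.
have [N [mN N0 sN]] := @ae_eq0_integral _ _ _ leb _ mf f0 i0.
have : lebesgue_measure `[0%R, 1%R] <= (0 : \bar R).
  rewrite -N0 le_measure ?inE// => u _; apply: sN => /= /eqP.
  by rewrite eqe gt_eqF// expR_gt0.
by rewrite lebesgue_measure_itv/= lte_fin ltr01 oppr0 adde0 lee_fin ler10.
Qed.

(** The integrand is at most a constant times [expR (- (s / 2 * |u|))], an even function that on the
    positive half-line is a multiple of the exponential density of rate [s / 2]. *)
Lemma integral_expR_expR_lty (s : R) : (0 < s)%R ->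
  \int[leb]_u (expR (s / 2 * u - expR u))%:E < +oo.
Proof.
move=> s0.
have cg : continuous (fun u : R => expR (- (s / 2 * `|u|)))%R.
  move=> u; apply: continuous_comp; last exact: continuous_expR.
  apply: cvgN; apply: cvgM; first exact: cvg_cst.
  exact: norm_continuous.
have mg : measurable_fun [set: R] (fun u : R => (expR (- (s / 2 * `|u|)))%:E).
  by apply/measurable_EFinP; exact: continuous_measurable_fun.
apply: (@le_lt_trans _ _
    (\int[leb]_u ((expR (s ^+ 2))%:E * (expR (- (s / 2 * `|u|)))%:E))).
  apply: ge0_le_integral => //.
  - apply/measurable_EFinP; apply: continuous_measurable_fun => u.
    by have := @continuous_integrand s 1 u; under eq_fun do rewrite mulr1.
  - exact: emeasurable_funM.
  - move=> u _; rewrite -EFinM -expRD lee_fin ler_expR.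
    have e0 := expR_gt0 u; have s20 := sqr_ge0 s.
    (* For [u < 0] the term [- expR u] is simply dropped. For [u >= 0],
       [expR u >= (u / 2) ^ 2 >= s * u - s ^ 2], the last step being [(s - u / 2) ^ 2 >= 0]. *)
    have [u0|u0] := ger0P u; last by rewrite mulrN opprK; lra.
    have -> : expR u = (expR (u / 2) ^+ 2)%R.
      by rewrite -expRM_natl mulrC divfK.
    have := expR_ge1Dx (u / 2) => e1.
    have : ((u / 2) ^+ 2 <= expR (u / 2) ^+ 2)%R.
      by rewrite lerXn2r ?nnegrE ?expR_ge0//; lra.
    have := sqr_ge0 (s - u / 2)%R; nra.
rewrite ge0_integralZl_EFin ?expR_ge0// lte_mul_pinfty ?lee_fin ?expR_ge0//.
rewrite ge0_symfun_integralT//; first last.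
  by move=> u; rewrite /= normrN.
rewrite lte_mul_pinfty ?lee_fin//.
have s20 : (0 < s / 2)%R by rewrite divr_gt0.
have pdf0 u : 0 <= (s / 2)^-1%:E * (exponential_pdf (s / 2) u)%:E.
  by rewrite -EFinM lee_fin mulr_ge0 ?invr_ge0 ?exponential_pdf_ge0 ?ltW.
have mpdf : measurable_fun [set: R] (fun u => (exponential_pdf (s / 2) u)%:E).
  by apply/measurable_EFinP; exact: measurable_exponential_pdf.
have mnn : measurable [set u : R | (0 <= u)%R] by rewrite -set_itvcy.
rewrite (_ : integral _ _ _ = \int[leb]_(u in [set u : R | (0 <= u)%R])
    ((s / 2)^-1%:E * (exponential_pdf (s / 2) u)%:E)); last first.
  apply: eq_integral => u; rewrite inE/= => u0; rewrite exponential_pdfE//.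
  by rewrite -EFinM mulKf ?gt_eqF// ger0_norm// mulNr.
apply: (@le_lt_trans _ _
    (\int[leb]_u ((s / 2)^-1%:E * (exponential_pdf (s / 2) u)%:E))).
  by apply: ge0_subset_integral => //; exact: emeasurable_funM.
rewrite ge0_integralZl_EFin ?invr_ge0 ?ltW//.
  by rewrite integral_exponential_pdf// mule1 ltry.
by move=> u _; rewrite lee_fin exponential_pdf_ge0// ltW.
Qed.

End subordination.

(** * The factor whose autocorrelation is the Riesz kernel *)

Section riesz_kernel.
Context (R : realType) (d : nat).
Implicit Types (s : R) (x y : euclidean R d).
Notation leb := (@lebesgue_measure R).
Notation mu := (lebesgue_euclidean R d).

(** The inverse square of this constant is what the two integrations below produce: the power of
    [Num.sqrt (pi / 4)] comes from the center [z], the remaining Gamma integral from [u]. *)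
Definition riesz_const s : R := (Num.sqrt
  (Num.sqrt (pi / 4) ^+ d *
   fine (\int[leb]_u (expR (s / 2 * u - expR u))%:E)%E))^-1.

(* A point [w] of [R^(d+1)] is read as a pair [(u, z)]: [u = tnth w ord0] is the
   logarithm of the inverse square width of the Gaussian, and the remaining
   coordinates are its center [z]. *)
Definition riesz_factor s (xw : euclidean R d * euclidean R d.+1) : R :=
  riesz_const s *
  expR ((s + d%:R) / 4 * tnth xw.2 ord0 - 2 * expR (tnth xw.2 ord0) *
    \sum_(i < d) ((tnth xw.1 i : R) - tnth xw.2 (lift ord0 i)) ^+ 2).

Lemma riesz_const_gt0 s : 0 < s -> 0 < riesz_const s.
Proof.
move=> s0; rewrite invr_gt0 sqrtr_gt0 mulr_gt0//.
  by rewrite exprn_gt0// sqrtr_gt0 divr_gt0// pi_gt0.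
by apply: fine_gt0; rewrite integral_expR_expR_gt0 integral_expR_expR_lty.
Qed.

Lemma riesz_factor_gt0 s xw : 0 < s -> 0 < riesz_factor s xw.
Proof. by move=> s0; rewrite mulr_gt0 ?expR_gt0// riesz_const_gt0. Qed.

Lemma measurable_riesz_factor s : measurable_fun [set: _] (riesz_factor s).
Proof.
have mt1 i : measurable_fun [set: euclidean R d * euclidean R d.+1]
    (fun xw => tnth xw.1 i : R).
  exact: (measurableT_comp (measurable_tnth i) measurable_fst).
have mt2 i : measurable_fun [set: euclidean R d * euclidean R d.+1]
    (fun xw => tnth xw.2 i : R).
  exact: (measurableT_comp (measurable_tnth i) measurable_snd).
apply: measurable_funM => //; apply: (measurableT_comp (@measurable_expR R)).
apply: measurable_funB; first exact: measurable_funM.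
apply: measurable_funM.
  apply: measurable_funM => //.
  exact: (measurableT_comp (@measurable_expR R)).
apply: measurable_sum => i; apply: measurable_funX.
exact: measurable_funB.
Qed.

Lemma euclidean_dist_ge0 x y : 0 <= euclidean_dist x y.
Proof. exact: sqrtr_ge0. Qed.

Lemma euclidean_dist_sqr x y :
  euclidean_dist x y ^+ 2 = \sum_(i < d) ((tnth x i : R) - tnth y i) ^+ 2.
Proof. by rewrite sqr_sqrtr// sumr_ge0// => i _; exact: sqr_ge0. Qed.

Lemma euclidean_dist_gt0 x y : x <> y -> 0 < euclidean_dist x y.
Proof.
move=> xy; rewrite lt_def euclidean_dist_ge0 andbT; apply/negP => /eqP xy0.
apply: xy; apply: eq_from_tnth => i.
have := euclidean_dist_sqr x y; rewrite xy0 expr0n/= => /esym/eqP.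
rewrite psumr_eq0 => [/allP/(_ i)|j _]; last exact: sqr_ge0.
by rewrite mem_index_enum => /(_ isT); rewrite sqrf_eq0 subr_eq0 => /eqP.
Qed.

(* Parallelogram law: |x-z|^2 + |y-z|^2 = 2 |z - (x+y)/2|^2 + |x-y|^2 / 2. *)
Lemma riesz_factorM s x y (u : R) (z : euclidean R d) :
  riesz_factor s (x, euclidean_cons (u, z)) *
  riesz_factor s (y, euclidean_cons (u, z)) =
  riesz_const s ^+ 2 *
  expR ((s + d%:R) / 2 * u - expR u * euclidean_dist x y ^+ 2) *
  expR (- ((4 * expR u) * \sum_(i < d)
    ((tnth z i : R) - ((tnth x i : R) + tnth y i) / 2) ^+ 2)).
Proof.
have z1 : tnth (euclidean_cons (u, z)) ord0 = u by rewrite (tnth_nth 0).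
have z2 i : tnth (euclidean_cons (u, z)) (lift ord0 i) = tnth z i.
  by rewrite !(tnth_nth 0).
rewrite /riesz_factor/= z1; under eq_bigr do rewrite z2.
under [in X in _ * (_ * expR X)]eq_bigr do rewrite z2.
rewrite mulrACA -[in RHS]mulrA -!expRD -expr2.
congr (_ * expR _); rewrite euclidean_dist_sqr.
have -> : \sum_(i < d) ((tnth z i : R) - ((tnth x i : R) + tnth y i) / 2) ^+ 2 =
    2^-1 * (\sum_(i < d) ((tnth x i : R) - tnth z i) ^+ 2 +
            \sum_(i < d) ((tnth y i : R) - tnth z i) ^+ 2) -
    4^-1 * \sum_(i < d) ((tnth x i : R) - tnth y i) ^+ 2.
  rewrite -big_split/= !mulr_sumr -sumrB; apply: eq_bigr => i _.
  by field.
by field.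
Qed.

Local Open Scope ereal_scope.

(** Integrating over [z] first leaves a Gaussian in the distance, which [integral_expR_expR] then
    integrates over [u]. For [x = y] the integral over [u] would diverge. *)
Lemma integral_riesz_factorM s x y : (0 < s)%R -> x <> y ->
  \int[lebesgue_euclidean R d.+1]_w
    (riesz_factor s (x, w) * riesz_factor s (y, w))%:E =
  ((euclidean_dist x y `^ s)^-1)%:E.
Proof.
move=> s0 xy; have r0 := euclidean_dist_gt0 xy.
have mF x' : measurable_fun [set: _] (fun w => riesz_factor s (x', w)).
  apply: (measurableT_comp (measurable_riesz_factor s)).
  by apply: measurable_fun_pair.
rewrite integral_lebesgue_euclideanS; first last.
- by move=> w; rewrite lee_fin mulr_ge0// ltW// riesz_factor_gt0.
- by apply/measurable_EFinP; exact: measurable_funM.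
pose I := \int[leb]_u (expR (s / 2 * u - expR u))%:E.
have Ifin : I \is a fin_num.
  rewrite ge0_fin_numE ?integral_expR_expR_lty//.
  exact/ltW/integral_expR_expR_gt0.
transitivity (\int[leb]_u ((riesz_const s ^+ 2 * Num.sqrt (pi / 4) ^+ d)%:E *
    (expR (s / 2 * u - expR u * euclidean_dist x y ^+ 2))%:E)).
  apply: eq_integral => u _.
  under eq_integral do rewrite riesz_factorM EFinM.
  rewrite ge0_integralZl_EFin//.
  - rewrite integral_gauss_euclidean ?mulr_gt0 ?expR_gt0//.
    rewrite -!EFinM; congr EFin.
    (* The [d]-th power of the root contributes [expR (- (d * u / 2))], which lowers the coefficient
       [(s + d) / 2] of [u] to [s / 2]. This is why [d] enters the exponent of [riesz_factor]. *)
    rewrite [(pi / (4 * expR u))%R](_ : _ = pi / 4 * expR (- (u / 2)) ^+ 2)%R.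
      rewrite sqrtrM ?divr_ge0 ?pi_ge0// sqrtr_sqr ger0_norm ?expR_ge0//.
      rewrite exprMn -expRM_natl.
      rewrite (_ : expR (s / 2 * u - _) =
        expR ((s + d%:R) / 2 * u - expR u * euclidean_dist x y ^+ 2) *
        expR (d%:R * - (u / 2)))%R; first by ring.
      by rewrite -expRD; congr expR; field.
    have -> : (expR (- (u / 2)) ^+ 2 = (expR u)^-1)%R.
      by rewrite -expRM_natl -expRN; congr expR; field.
    by field; rewrite gt_eqF// expR_gt0.
  - apply/measurable_EFinP; apply: (measurableT_comp (@measurable_expR R)).
    apply: measurableT_comp => //; apply: measurable_funM => //.
    exact: measurable_sum_sqr.
  - by rewrite mulr_ge0 ?sqr_ge0 ?expR_ge0.
rewrite ge0_integralZl_EFin//; first last.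
- by rewrite mulr_ge0 ?sqr_ge0 ?exprn_ge0.
- apply/measurable_EFinP; apply: (measurableT_comp (@measurable_expR R)).
  by apply: measurable_funB; apply: measurable_funM => //.
rewrite integral_expR_expR// -/I -(fineK Ifin) -!EFinM; congr EFin.
rewrite powRN mulrCA -[RHS]mulr1; congr (_ * _)%R.
rewrite /riesz_const exprVn sqr_sqrtr ?mulr_ge0 ?exprn_ge0//; last first.
  by rewrite fine_ge0// ltW// integral_expR_expR_gt0.
rewrite -/I -mulrA mulVf// mulf_neq0 ?expf_neq0//.
  by rewrite gt_eqF// sqrtr_gt0 divr_gt0// pi_gt0.
by rewrite gt_eqF// fine_gt0// integral_expR_expR_gt0 integral_expR_expR_lty.
Qed.

Lemma measurable_euclidean_dist x :
  measurable_fun [set: euclidean R d] (euclidean_dist x).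
Proof.
apply: (measurableT_comp (continuous_measurable_fun (@sqrt_continuous R))).
apply: measurable_sum => i; apply: measurable_funX.
by apply: measurable_funB => //; exact: measurable_tnth.
Qed.

End riesz_kernel.

Lemma lebesgue_euclidean_neq0 (R : realType) (d : nat) :
  lebesgue_euclidean R d [set: _] != 0%E.
Proof.
elim: d => [|d ih]; first by rewrite /= diracT onee_eq0.
rewrite /= /lebesgue_succ /pushforward preimage_setT -setXTT.
rewrite product_measure1E//.
rewrite mule_neq0//; apply/eqP => leb0.
have : (lebesgue_measure `[0%R, 1%R] <= (0 : \bar R))%E.
  by rewrite -leb0 le_measure ?inE.
by rewrite lebesgue_measure_itv/= lte_fin ltr01 oppr0 adde0 lee_fin ler10.
Qed.

(** * The Rollnik norm as a kernel norm *)

Section rollnik_knorm.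
Context (R : realType) (d : nat) (alpha : R).
Hypotheses (alpha_gt0 : 0 < alpha) (alpha_ltd : alpha < d%:R).
Implicit Types V W : euclidean R d -> R.
Notation mu := (lebesgue_euclidean R d).
Notation nu := (lebesgue_euclidean R d.+1).
Local Open Scope ereal_scope.

Let s : R := (2 * (d%:R - alpha))%R.

Let s_gt0 : (0 < s)%R. Proof. by rewrite mulr_gt0// subr_gt0. Qed.

Definition rollnik_knorm := knorm mu nu (riesz_factor (d := d) s).

Lemma rollnik_normE V : measurable_fun [set: euclidean R d] V ->
  rollnik_norm alpha V = rollnik_knorm (fun x => `|V x|%:E).
Proof.
move=> mV; have d0 : (0 < d)%N.
  by rewrite -(ltr_nat R); exact: lt_trans alpha_ltd.
rewrite /rollnik_knorm.
rewrite (@knormE _ _ _ _ _ mu nu _ (measurable_riesz_factor (d := d) s)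
   (fun xw => riesz_factor_gt0 xw s_gt0)
   (fun x y => ((euclidean_dist x y `^ s)^-1)%R)).
- by rewrite /rollnik_norm; congr (_ `^ _).
- move=> x; under eq_fun do rewrite -powRN.
  exact: (measurableT_comp (measurable_powR (- s))
    (measurable_euclidean_dist x)).
- by move=> x y; rewrite invr_ge0 powR_ge0.
- move=> x; apply: filterS (ae_neq_euclidean x d0) => y yx.
  by rewrite integral_riesz_factorM//; exact/nesym.
- by apply/measurable_EFinP; exact: measurableT_comp.
- by move=> x; rewrite lee_fin.
Qed.

End rollnik_knorm.

(** * The space of Rollnik potentials *)

Section halves.
Context (R : realType).

Lemma sum_expr2V_le (n m : nat) :
  \sum_(0 <= k < m) 2^-1 ^+ (n + k) <= 2 * 2^-1 ^+ n :> R.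
Proof.
suff -> : \sum_(0 <= k < m) 2^-1 ^+ (n + k) =
    2 * 2^-1 ^+ n - 2 * 2^-1 ^+ (n + m) :> R.
  by rewrite lerBlDr lerDl mulr_ge0// exprn_ge0// invr_ge0.
elim: m => [|m ih]; first by rewrite big_nil addn0 subrr.
by rewrite big_nat_recr//= ih addnS exprS; field.
Qed.

Lemma eseries_expr2V_le (n : nat) :
  (\sum_(k <oo) (2^-1 ^+ (n + k))%:E <= (2 * 2^-1 ^+ n : R)%:E)%E.
Proof.
apply: lime_le.
  by apply: is_cvg_nneseries => k _ _; rewrite lee_fin exprn_ge0// invr_ge0.
by apply: nearW => m; rewrite sumEFin lee_fin sum_expr2V_le.
Qed.

(** Bounds the distance between the centers of two consecutive meeting balls in the completeness
    proof. *)
Lemma expr2V_consecutive_le (n : nat) :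
  2^-1 ^+ n.+2 + 2^-1 ^+ n.+1 <= 2^-1 ^+ n :> R.
Proof.
have : 0 <= 2^-1 ^+ n :> R by rewrite exprn_ge0// invr_ge0.
by rewrite !exprS; set h := 2^-1 ^+ n; lra.
Qed.

Lemma expr2V_small (e : R) : 0 < e ->
  exists n, 2 * 2^-1 ^+ n + 2^-1 ^+ n.+1 < e.
Proof.
(* With [h = 2^-1 ^+ n] the left side is [5 / 2 * h], so [3 * h < e] is enough. *)
move=> e0; have e3 : 0 < e / 3 by rewrite divr_gt0.
have [n _ /(_ n (leqnn n))] := near_infty_natSinv_expn_lt (PosNum e3).
rewrite /= div1r -exprVn ltr_pdivlMr// => ne; exists n; apply: le_lt_trans ne.
have : 0 <= 2^-1 ^+ n :> R by rewrite exprn_ge0// invr_ge0.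
by rewrite !exprS; set h := 2^-1 ^+ n; lra.
Qed.

End halves.

(** * Norm properties and almost everywhere classes *)

Section rollnik_space.
Context (R : realType) (d : nat) (alpha : R).
Hypotheses (alpha_gt0 : 0 < alpha) (alpha_ltd : alpha < d%:R).
Notation T := (euclidean R d).
Notation mu := (lebesgue_euclidean R d).
Notation nu := (lebesgue_euclidean R d.+1).
Notation N := (rollnik_knorm (R := R) (d := d) alpha).
Implicit Types (f g : T -> R) (V W : rollnik d alpha).

Lemma measurable_rollnik V : measurable_fun [set: T] (V : T -> R).
Proof. exact: (@measurable_funPT _ _ _ _ (repr (rollnik_class V))). Qed.

(** Representatives equal almost everywhere define the same class, and the proof of finiteness is
    unique because the condition is boolean. *)
Lemma eq_rollnik V W : V = W %[ae mu] -> V = W.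
Proof.
case: V W => [v vP] [w wP] /= vw.
have {}vw : v = w.
  by apply/eqP; rewrite -[v]reprK -[w]reprK eqmodE; exact/asboolP.
subst w; congr Rollnik; exact: bool_irrelevance.
Qed.

(** Makes the norm, computed on the canonical representative, computable on any measurable one. *)
Lemma ae_eq_rollnik_norm f g : measurable_fun [set: T] f ->
  measurable_fun [set: T] g -> f = g %[ae mu] ->
  rollnik_norm alpha f = rollnik_norm alpha g.
Proof.
move=> mf mg fg; rewrite !rollnik_normE//; apply: ae_eq_knorm.
- exact: measurable_riesz_factor.
- by move=> xw; apply: riesz_factor_gt0; rewrite mulr_gt0// subr_gt0.
- by apply/measurable_EFinP; exact: measurableT_comp.
- by apply/measurable_EFinP; exact: measurableT_comp.
- by move=> x; rewrite lee_fin.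
- by move=> x; rewrite lee_fin.
- by apply: filterS fg => x /(_ I) ->.
Qed.

Let s_gt0 : 0 < 2 * (d%:R - alpha). Proof. by rewrite mulr_gt0// subr_gt0. Qed.

Let mphi := measurable_riesz_factor (R := R) (d := d) (2 * (d%:R - alpha)).

Let phi0 xw := riesz_factor_gt0 (d := d) xw s_gt0.

Let mnorm f : measurable_fun [set: T] f ->
  measurable_fun [set: T] (fun x => `|f x|%:E).
Proof. by move=> mf; apply/measurable_EFinP; exact: measurableT_comp. Qed.

Let norm0 f x : (0 <= `|f x|%:E)%E. Proof. by rewrite lee_fin. Qed.

Lemma rollnik_norm_ge0 f : (0 <= rollnik_norm alpha f)%E.
Proof. exact: poweR_ge0. Qed.

(** The pointwise triangle inequality and monotonicity of [knorm] reduce the claim to nonnegative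
    functions. *)
Lemma rollnik_normD f g : measurable_fun [set: T] f ->
  measurable_fun [set: T] g ->
  (rollnik_norm alpha (f \+ g)%R <=
   rollnik_norm alpha f + rollnik_norm alpha g)%E.
Proof.
move=> mf mg; rewrite !rollnik_normE//; last exact: measurable_funD.
rewrite /rollnik_knorm.
apply: le_trans (ge0_knormD mu nu mphi phi0 (mnorm mf) (mnorm mg)
  (norm0 f) (norm0 g)).
apply: (ae_ge0_le_knorm nu mphi phi0) => //.
- by apply: mnorm; exact: measurable_funD.
- by apply: emeasurable_funD; exact: mnorm.
- by move=> x; exact: adde_ge0.
- by apply: aeW => x; rewrite /= -EFinD lee_fin ler_normD.
Qed.

Lemma rollnik_normZ a f : measurable_fun [set: T] f ->
  rollnik_norm alpha (fun x => a * f x) = (`|a|%:E * rollnik_norm alpha f)%E.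
Proof.
move=> mf; rewrite !rollnik_normE//; last exact: measurable_funM.
rewrite -(ge0_knormZ mu nu mphi phi0 (mnorm mf) (norm0 f) (normr_ge0 a)).
by congr knorm; apply/funext => x; rewrite normrM EFinM.
Qed.

Lemma rollnik_norm_eq0 f : measurable_fun [set: T] f ->
  rollnik_norm alpha f = 0%E -> f = cst 0 %[ae mu].
Proof.
move=> mf; rewrite rollnik_normE//.
move=> /(knorm_eq0 mphi phi0 (lebesgue_euclidean_neq0 R d.+1)
  (mnorm mf) (norm0 f)).
by apply: filterS => x [/eqP]; rewrite normr_eq0 => /eqP.
Qed.

Lemma rollnik_norm_riesz_fischer (u : nat -> T -> R) :
  (forall n, measurable_fun [set: T] (u n)) ->
  (\sum_(k <oo) rollnik_norm alpha (u k.+1 \- u k)%R < +oo)%E ->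
  exists2 v : T -> R, measurable_fun [set: T] v & forall n,
    (rollnik_norm alpha (v \- u n)%R <=
     \sum_(k <oo) rollnik_norm alpha (u (n + k).+1 \- u (n + k)%N)%R)%E.
Proof.
move=> mu_; have mB i j : measurable_fun [set: T] (u i \- u j).
  exact: measurable_funB.
have NE i j := rollnik_normE alpha_gt0 alpha_ltd (mB i j).
rewrite [X in (X < _)%E -> _](eq_eseriesr (fun k _ => NE k.+1 k)) => uoo.
have [v mv uv] := knorm_riesz_fischer mphi phi0 (lebesgue_euclidean_neq0 R d.+1)
  mu_ uoo.
exists v => // n.
rewrite (rollnik_normE alpha_gt0 alpha_ltd (measurable_funB mv (mu_ n))).
rewrite [leRHS](eq_eseriesr (fun k _ => NE (n + k).+1 (n + k)%N)).
exact: uv.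
Qed.

Lemma ex_rollnik f : measurable_fun [set: T] f ->
  (rollnik_norm alpha f < +oo)%E ->
  exists V : rollnik d alpha, (V : T -> R) = f %[ae mu].
Proof.
move=> mf foo.
pose g : {mfun T >-> measurableTypeR R} :=
  @mfun_Sub _ _ T (measurableTypeR R) f (mem_set mf).
pose C : {mfun_ mu, T >-> measurableTypeR R} :=
  \pi_({mfun_ mu, T >-> measurableTypeR R})%qT g.
have Cf : (C : T -> R) = f %[ae mu].
  have : repr C == g %[mod {mfun_ mu, T >-> measurableTypeR R}]%qT.
    by rewrite reprK.
  by rewrite eqmodE => /asboolP.
suff Coo : (rollnik_norm alpha C < +oo)%E by exists (Rollnik Coo).
rewrite (ae_eq_rollnik_norm (g := f))//.
exact: (@measurable_funPT _ _ _ _ (repr C)).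
Qed.

(** The choice is harmless, since [eq_rollnik] makes the chosen element unique. *)
Definition rollnik_of f (mf : measurable_fun [set: T] f)
    (foo : (rollnik_norm alpha f < +oo)%E) : rollnik d alpha :=
  projT1 (cid (ex_rollnik mf foo)).

Lemma rollnik_ofE f (mf : measurable_fun [set: T] f)
    (foo : (rollnik_norm alpha f < +oo)%E) :
  (rollnik_of mf foo : T -> R) = f %[ae mu].
Proof. exact: (projT2 (cid (ex_rollnik mf foo))). Qed.

End rollnik_space.

(* The hypotheses are parameters of this alias so that the structures below,
   which depend on them, can be canonical instances. *)
Definition rollnik_space (R : realType) (d : nat) (alpha : R)
  (alpha_gt0 : 0 < alpha) (alpha_ltd : alpha < d%:R) : Type := rollnik d alpha.

(** * Vector space structure, norm and completeness *)

Section rollnik_lmodule.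
Context (R : realType) (d : nat) (alpha : R).
Hypotheses (alpha_gt0 : 0 < alpha) (alpha_ltd : alpha < d%:R).
Notation T := (euclidean R d).
Notation mu := (lebesgue_euclidean R d).
Notation B := (rollnik_space alpha_gt0 alpha_ltd).
Implicit Types V W : B.

HB.instance Definition _ := gen_eqMixin B.
HB.instance Definition _ := gen_choiceMixin B.

Let fct V : T -> R := (V : rollnik d alpha).
Let mfct V : measurable_fun [set: T] (fct V).
Proof. exact: measurable_rollnik. Qed.

Lemma rollnik_cst0_lty : (rollnik_norm alpha (cst 0%R : T -> R) < +oo)%E.
Proof.
(* Homogeneity with the scalar 0 yields norm 0 at once. *)
rewrite (_ : cst 0 = (fun x => 0 * (cst 0 : T -> R) x)); last first.
  by apply/funext => x; rewrite mul0r.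
by rewrite rollnik_normZ// normr0 mul0e ltry.
Qed.

Lemma rollnik_scale_lty a V :
  (rollnik_norm alpha (fun x => (a * fct V x)%R) < +oo)%E.
Proof.
by rewrite rollnik_normZ// lte_mul_pinfty ?lee_fin//; exact: rollnik_norm_lty.
Qed.

Lemma rollnik_add_lty V W : (rollnik_norm alpha (fct V \+ fct W)%R < +oo)%E.
Proof.
apply: le_lt_trans (rollnik_normD alpha_gt0 alpha_ltd (mfct V) (mfct W)) _.
by rewrite lte_add_pinfty//; exact: rollnik_norm_lty.
Qed.

Definition rollnik0 : B :=
  rollnik_of alpha_gt0 alpha_ltd (measurable_cst (0 : R)) rollnik_cst0_lty.

Definition rollnik_scale a V : B :=
  rollnik_of alpha_gt0 alpha_ltd
    (measurable_funM (measurable_cst (a : R)) (mfct V)) (rollnik_scale_lty a V).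

Definition rollnik_add V W : B :=
  rollnik_of alpha_gt0 alpha_ltd
    (measurable_funD (mfct V) (mfct W)) (rollnik_add_lty V W).

Lemma rollnik0E : fct rollnik0 = cst 0 %[ae mu].
Proof. exact: rollnik_ofE. Qed.

Lemma rollnik_scaleE a V :
  fct (rollnik_scale a V) = (fun x => a * fct V x) %[ae mu].
Proof. exact: rollnik_ofE. Qed.

Lemma rollnik_addE V W :
  fct (rollnik_add V W) = (fun x => fct V x + fct W x) %[ae mu].
Proof. exact: rollnik_ofE. Qed.

Let eq_fct V W : fct V = fct W %[ae mu] -> V = W. Proof. exact: eq_rollnik. Qed.

(** As for the other module laws, the identity holds at each point where all the representatives
    involved take their expected values; the [filterS] lemmas intersect these full-measure sets. *)
Lemma rollnik_addA : associative rollnik_add.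
Proof.
move=> V W Z; apply: eq_fct.
apply: filterS3 (rollnik_addE V (rollnik_add W Z)) (rollnik_addE W Z)
  (filterI (rollnik_addE (rollnik_add V W) Z) (rollnik_addE V W))
  => x + + [+ +] xT.
by move=> /(_ xT) -> /(_ xT) -> /(_ xT) -> /(_ xT) ->; exact: addrA.
Qed.

Lemma rollnik_addC : commutative rollnik_add.
Proof.
move=> V W; apply: eq_fct.
apply: filterS2 (rollnik_addE V W) (rollnik_addE W V) => x + + xT.
by move=> /(_ xT) -> /(_ xT) ->; exact: addrC.
Qed.

Lemma rollnik_add0 : left_id rollnik0 rollnik_add.
Proof.
move=> V; apply: eq_fct.
apply: filterS2 (rollnik_addE rollnik0 V) rollnik0E => x + + xT.
by move=> /(_ xT) -> /(_ xT) ->; exact: add0r.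
Qed.

Lemma rollnik_addN : left_inverse rollnik0 (rollnik_scale (-1)) rollnik_add.
Proof.
move=> V; apply: eq_fct.
apply: filterS3 (rollnik_addE (rollnik_scale (-1) V) V)
  (rollnik_scaleE (-1) V) rollnik0E => x + + + xT.
move=> /(_ xT) -> /(_ xT) -> /(_ xT) ->.
by rewrite mulN1r addNr.
Qed.

HB.instance Definition _ := GRing.isZmodule.Build B
  rollnik_addA rollnik_addC rollnik_add0 rollnik_addN.

Lemma rollnik_scaleA a b V :
  rollnik_scale a (rollnik_scale b V) = rollnik_scale (a * b) V.
Proof.
apply: eq_fct.
apply: filterS3 (rollnik_scaleE a (rollnik_scale b V))
  (rollnik_scaleE b V) (rollnik_scaleE (a * b) V) => x + + + xT.
by move=> /(_ xT) -> /(_ xT) -> /(_ xT) ->; exact: mulrA.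
Qed.

Lemma rollnik_scale1 : left_id 1 rollnik_scale.
Proof.
move=> V; apply: eq_fct.
by apply: filterS (rollnik_scaleE 1 V) => x + xT => /(_ xT) ->; exact: mul1r.
Qed.

Lemma rollnik_scaleDr : right_distributive rollnik_scale +%R.
Proof.
move=> a V W; apply: eq_fct.
apply: filterS3 (filterI (rollnik_scaleE a (V + W)) (rollnik_addE V W))
  (rollnik_addE (rollnik_scale a V) (rollnik_scale a W))
  (filterI (rollnik_scaleE a V) (rollnik_scaleE a W)) => x [+ +] + [+ +] xT.
move=> /(_ xT) -> /(_ xT) -> /(_ xT) -> /(_ xT) -> /(_ xT) ->.
exact: mulrDr.
Qed.

Lemma rollnik_scaleDl V : {morph rollnik_scale^~ V : a b / a + b}.
Proof.
move=> a b; apply: eq_fct.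
apply: filterS3 (rollnik_scaleE (a + b) V)
  (filterI (rollnik_scaleE a V) (rollnik_scaleE b V))
  (rollnik_addE (rollnik_scale a V) (rollnik_scale b V)) => x + [+ +] + xT.
move=> /(_ xT) -> /(_ xT) Ea /(_ xT) Eb /(_ xT) ->.
by rewrite Ea Eb; exact: mulrDl.
Qed.

HB.instance Definition _ := GRing.Zmodule_isLmodule.Build R B
  rollnik_scaleA rollnik_scale1 rollnik_scaleDr rollnik_scaleDl.

Definition rollnik_fnorm V : R := fine (rollnik_norm alpha (fct V)).

Lemma rollnik_fnormE V : (rollnik_fnorm V)%:E = rollnik_norm alpha (fct V).
Proof.
by rewrite fineK// ge0_fin_numE ?rollnik_norm_ge0//; exact: rollnik_norm_lty.
Qed.

Lemma rollnik_fnormD V W :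
  rollnik_fnorm (V + W) <= rollnik_fnorm V + rollnik_fnorm W.
Proof.
rewrite -lee_fin EFinD.
rewrite [leLHS]rollnik_fnormE [X in (_ <= X + _)%E]rollnik_fnormE.
rewrite [X in (_ <= _ + X)%E]rollnik_fnormE.
rewrite (ae_eq_rollnik_norm alpha_gt0 alpha_ltd (mfct _) _ (rollnik_addE V W)).
  exact: rollnik_normD.
exact: measurable_funD.
Qed.

Lemma rollnik_fnormZ a V : rollnik_fnorm (a *: V) = `|a| * rollnik_fnorm V.
Proof.
apply: EFin_inj; rewrite EFinM.
rewrite [LHS]rollnik_fnormE [X in (_ = _ * X)%E]rollnik_fnormE.
rewrite (ae_eq_rollnik_norm alpha_gt0 alpha_ltd (mfct _) _
  (rollnik_scaleE a V)).
  exact: rollnik_normZ.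
exact: measurable_funM.
Qed.

Lemma rollnik_fnorm_eq0 V : rollnik_fnorm V = 0 -> V = 0.
Proof.
move=> V0; apply: eq_fct; apply: ae_eq_trans (ae_eq_sym rollnik0E).
apply: (rollnik_norm_eq0 alpha_gt0 alpha_ltd (mfct V)).
by have := rollnik_fnormE V; rewrite V0.
Qed.

HB.instance Definition _ := @Lmodule_isNormed.Build R B
  rollnik_fnorm rollnik_fnormD rollnik_fnormZ rollnik_fnorm_eq0.

Lemma rollnik_subE V W :
  fct (V - W) = (fun x => fct V x - fct W x) %[ae mu].
Proof.
(* By construction [- W] is [rollnik_scale (-1) W]. *)
apply: filterS2 (rollnik_addE V (- W)) (rollnik_scaleE (-1) W) => x + + xT.
by move=> /(_ xT) -> /(_ xT) E; congr (_ + _); rewrite -mulN1r; exact: E.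
Qed.

Lemma rollnik_distE V W :
  `|V - W|%:E = rollnik_norm alpha (fct V \- fct W).
Proof.
transitivity (rollnik_norm alpha (fct (V - W))); first exact: rollnik_fnormE.
apply: (ae_eq_rollnik_norm alpha_gt0 alpha_ltd _ _ (rollnik_subE V W)).
  exact: mfct.
exact: measurable_funB.
Qed.

(** The Cauchy filter yields a sequence of ball centers with summable increments; its Riesz-Fischer
    limit is then shown to be a limit of the filter itself. *)
Lemma rollnik_cauchy_cvg (F : set_system B) :
  ProperFilter F -> cauchy F -> cvg F.
Proof.
move=> FF /cauchyP Fc.
(* Balls of radius [2^-1 ^+ n.+1] belonging to the filter meet pairwise, so consecutive centers are
   at most [2^-1 ^+ n] apart. *)
have e0 n : 0 < 2^-1 ^+ n.+1 :> R by rewrite exprn_gt0// invr_gt0.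
have [u uF] := choice (fun n => Fc _ (e0 n)).
have du n : `|u n.+1 - u n| <= 2^-1 ^+ n.
  have [y []] := filter_ex (filterI (uF n.+1) (uF n)).
  rewrite -!ball_normE/= => y1 y2.
  rewrite (le_trans (ler_distD y _ _))// (distrC y).
  apply: (le_trans (lerD (ltW y1) (ltW y2))).
  exact: expr2V_consecutive_le.
pose f n := fct (u n).
have mf n : measurable_fun [set: T] (f n) by exact: mfct.
have tail n :
    (\sum_(k <oo) rollnik_norm alpha (f (n + k).+1 \- f (n + k)%N)%R <=
     (2 * 2^-1 ^+ n)%:E)%E.
  apply: le_trans (eseries_expr2V_le R n); apply: lee_nneseries => k _.
    by move=> _; exact: rollnik_norm_ge0.
  by rewrite -rollnik_distE lee_fin.
have [|v mv uv] := rollnik_norm_riesz_fischer alpha_gt0 alpha_ltd mf.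
  by apply: le_lt_trans (tail 0%N) _; rewrite ltry.
have voo : (rollnik_norm alpha v < +oo)%E.
  (* Finiteness is inherited from [f 0], as the difference has norm at most 2 by [tail 0]. *)
  rewrite (_ : v = (v \- f 0%N) \+ f 0%N); last first.
    by apply/funext => x /=; rewrite subrK.
  apply: le_lt_trans (rollnik_normD alpha_gt0 alpha_ltd _ (mf 0%N)) _.
    exact: measurable_funB.
  apply: lte_add_pinfty; last exact: rollnik_norm_lty.
  by apply: le_lt_trans (le_trans (uv 0%N) (tail 0%N)) _; rewrite ltry.
pose V : B := rollnik_of alpha_gt0 alpha_ltd mv voo.
have uV n : `|V - u n| <= 2 * 2^-1 ^+ n.
  rewrite -lee_fin rollnik_distE; apply: le_trans (tail n).
  apply: le_trans (uv n).
  rewrite (@ae_eq_rollnik_norm _ _ _ alpha_gt0 alpha_ltd _ (v \- f n))//.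
  - exact: measurable_funB.
  - exact: measurable_funB.
  - apply: filterS (rollnik_ofE alpha_gt0 alpha_ltd mv voo) => x + xT.
    by move=> /(_ xT) E; congr (_ - _); exact: E.
apply/cvg_ex; exists V; apply/cvg_ballP => e epos.
have [n ne] := expr2V_small epos.
apply: filterS (uF n) => y; rewrite -!ball_normE/= => uy.
rewrite (le_lt_trans (ler_distD (u n) _ _))// (le_lt_trans _ ne)//.
exact: (lerD (uV n) (ltW uy)).
Qed.

HB.instance Definition _ := Uniform_isComplete.Build B rollnik_cauchy_cvg.

End rollnik_lmodule.

(** The three clauses tie the structure to the pointwise operations and to the Rollnik norm, so that
    an unrelated Banach structure on the same set does not qualify. *)
Theorem theorem3p6 (R : realType) (d : nat) (alpha : R)
    (alpha_gt0 : 0 < alpha) (alpha_lt2 : alpha < 2)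
    (alpha_ltd : alpha < d%:R) (d_lt2alpha : d%:R < 2 * alpha) :
  exists c : CompleteNormedModule R (rollnik d alpha),
    let B : completeNormedModType R := CompleteNormedModule.Pack c in
    [/\ forall V W : B,
          ((V + W : B) : rollnik d alpha) =
            (fun x => (V : rollnik d alpha) x + (W : rollnik d alpha) x)
            %[ae lebesgue_euclidean R d],
        forall (a : R) (V : B),
          ((a *: V : B) : rollnik d alpha) =
            (fun x => a * (V : rollnik d alpha) x)
            %[ae lebesgue_euclidean R d] &
        forall V : B, `|V|%:E = rollnik_norm alpha (V : rollnik d alpha)].
Proof.
(* The alias [rollnik_space] unfolds to [rollnik d alpha], so its structure has the required
   type. *)
exists (CompleteNormedModule.class (rollnik_space alpha_gt0 alpha_ltd)); split.
- move=> V W; exact: (rollnik_addE (V : rollnik_space alpha_gt0 alpha_ltd) W).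
- move=> a V; exact: (rollnik_scaleE a (V : rollnik_space alpha_gt0 alpha_ltd)).
- move=> V; exact: (rollnik_fnormE (V : rollnik_space alpha_gt0 alpha_ltd)).
Qed.
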